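(* Let $\mathcal{S}$ be the family consisting of the spaces $\ell^\infty$, $c_0$, $\ell^s$ for $0<s<+\infty$, and $\bigcap_{s>a}\ell^s$ for $0\le a<+\infty$. Let $X=\ell^p$ with $0<p<+\infty$, and let $Y\in\mathcal{S}$ satisfy $Y\supset X$ and $Y\setminus X\neq\emptyset$. Then $X$ is an $F_\sigma$ meager subset of $Y$.
   Context: All spaces are spaces of complex sequences $f=(f(n))_{n\ge1}$, with their natural complete metrizable vector space topologies: $\ell^\infty$ and $c_0$ carry the sup norm; $\ell^s$ for $1\le s<\infty$ carries the norm $\|f\|_s=(\sum_n|f(n)|^s)^{1/s}$; $\ell^s$ for $0<s<1$ carries the metric $d_s(f,g)=\sum_n|f(n)-g(n)|^s$; and $\bigcap_{s>a}\ell^s$ (intersection over all finite $s>a$) carries the metrizable topology in which $f_m\to f$ iff $f_m\to f$ in $\ell^s$ for every $s\in(a,+\infty)$. ''$X$ is an $F_\sigma$ meager subset of $Y$'' means that $X$ is equal to a countable union of closed subsets of $Y$ each with empty interior in $Y$; equivalently, $Y\setminus X$ is a dense $G_\delta$ subset of $Y$. *)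

(* Defs.v *)
From HB Require Import structures.
From mathcomp Require Import all_boot all_order all_algebra.
From mathcomp Require Import complex.
From mathcomp Require Import all_classical all_reals all_analysis.

Set Implicit Arguments.
Unset Strict Implicit.
Unset Printing Implicit Defensive.

Import Order.TTheory GRing.Theory Num.Theory.
Import numFieldNormedType.Exports ComplexField.Normc.

Local Open Scope classical_set_scope.
Local Open Scope ring_scope.

(* Sequences are indexed by nat, so that [f n] stands for the (n+1)-st term;  *)
(* [normc z : R] is the modulus of [z : R[i]].                                *)

(* Locked to keep unification from unfolding the series.                      *)
HB.lock Definition pow_sum (R : realType) (s : R) (f : nat -> R[i]) : \bar R :=
  (\sum_(n <oo) (normc (f n) `^ s)%:E)%E.

Section Carriers.
Context {R : realType}.
Implicit Types (f g h : nat -> R[i]) (s : R).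

Definition linf_set : set (nat -> R[i]) :=
  [set f | has_ubound (range (fun n => normc (f n)))].

Definition c0_set : set (nat -> R[i]) :=
  [set f | normc (f n) @[n --> \oo] --> (0 : R)].

Definition ell_set s : set (nat -> R[i]) := [set f | (pow_sum s f < +oo)%E].

Definition capell_set (a : R) : set (nat -> R[i]) :=
  \bigcap_(s in [set s | a < s]) ell_set s.

Definition sup_dist f g : R := sup (range (fun n => normc (f n - g n))).

(* The metric of ell^s: induced by the norm if s >= 1, d_s if 0 < s < 1.      *)
Definition ell_dist s f g : R :=
  if 1 <= s then fine (pow_sum s (f \- g)) `^ s^-1
  else fine (pow_sum s (f \- g)).

Lemma normc_ge0 (z : R[i]) : 0 <= normc z.
Proof. by case: z => a b; exact: sqrtr_ge0. Qed.

Lemma normc_distC (z w : R[i]) : normc (z - w) = normc (w - z).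
Proof. by rewrite -normcN opprB. Qed.

Lemma normc_dist_triangle f g h n :
  normc ((f \- h) n) <= normc ((f \- g) n) + normc ((g \- h) n).
Proof. by rewrite /= (le_trans _ (le_normcD _ _))//= addrA subrK. Qed.

Lemma linf_setB f g : linf_set f -> linf_set g -> linf_set (f \- g).
Proof.
move=> [M fM] [N gN]; exists (M + N) => _ [n _ <-] /=.
rewrite (le_trans (le_normcD _ _))// normcN lerD//; [exact: fM|exact: gN].
Qed.

Lemma c0_set_linf f : c0_set f -> linf_set f.
Proof.
move=> /cvgP/cvg_seq_bounded[M [_ /(_ (M + 1))]].
rewrite ltrDl ltr01 => /(_ isT) fM; exists (M + 1) => _ [n _ <-] /=.
by rewrite (le_trans (ler_norm _))//; exact: fM.
Qed.

Lemma sup_distxx f : sup_dist f f = 0.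
Proof.
suff /(congr1 sup) : range (fun n => normc (f n - f n)) = [set 0] by rewrite sup1.
apply/seteqP; split => [_ [n _ <-]|_ ->] /=; first by rewrite subrr normc0.
by exists 0%N => //=; rewrite subrr normc0.
Qed.

Lemma sup_dist_sym f g : sup_dist f g = sup_dist g f.
Proof.
rewrite /sup_dist; congr (sup _); apply: eq_imagel => n _.
exact: normc_distC.
Qed.

Lemma le_sup_dist f g n : linf_set f -> linf_set g ->
  normc (f n - g n) <= sup_dist f g.
Proof.
move=> lf lg; apply: ub_le_sup; first exact: linf_setB.
by exists n.
Qed.

Lemma sup_dist_eq0 f g : linf_set f -> linf_set g -> sup_dist f g = 0 -> f = g.
Proof.
move=> lf lg fg0; apply/funext => n; apply/eqP; rewrite -subr_eq0; apply/eqP.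
apply: eq0_normc; apply/eqP; rewrite eq_le normc_ge0 andbT -fg0.
exact: le_sup_dist.
Qed.

Lemma sup_dist_triangle g f h : linf_set f -> linf_set g -> linf_set h ->
  sup_dist f h <= sup_dist f g + sup_dist g h.
Proof.
move=> lf lg lh; apply: ge_sup; first by exists (normc (f 0%N - h 0%N)), 0%N.
move=> _ [n _ <-]; apply: (le_trans (normc_dist_triangle f g h n)).
by apply: lerD; exact: le_sup_dist.
Qed.

Lemma pow_sum_ge0 s f : (0 <= pow_sum s f)%E.
Proof. by rewrite pow_sum.unlock; apply: nneseries_ge0 => n _ _; rewrite lee_fin powR_ge0. Qed.

Lemma pow_sum_fin s f : ell_set s f -> pow_sum s f \is a fin_num.
Proof. by move=> sf; rewrite ge0_fin_numE// pow_sum_ge0. Qed.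

Lemma le_pow_sum s f n : ((normc (f n) `^ s)%:E <= pow_sum s f)%E.
Proof.
rewrite pow_sum.unlock.
apply: (@le_trans _ _ (\sum_(0 <= k < n.+1) (normc (f k) `^ s)%:E)%E).
  rewrite big_nat_recr//= leeDr// sume_ge0// => k _.
  by rewrite lee_fin powR_ge0.
by apply: nneseries_lim_ge => k _ _; rewrite lee_fin powR_ge0.
Qed.

Lemma pow_sum_distC s f g : pow_sum s (f \- g) = pow_sum s (g \- f).
Proof.
by rewrite pow_sum.unlock; apply: eq_eseriesr => n _ /=; rewrite normc_distC.
Qed.

Lemma pow_sumxx s f : 0 < s -> pow_sum s (f \- f) = 0%E.
Proof.
move=> s0; rewrite pow_sum.unlock; apply: eseries0 => n _ _ /=.
by rewrite subrr normc0 powR0// gt_eqF.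
Qed.

Lemma powR_leD s (x y : R) : 0 <= s -> 0 <= x -> 0 <= y ->
  (x + y) `^ s <= 2 `^ s * x `^ s + 2 `^ s * y `^ s.
Proof.
move=> s0 x0 y0; rewrite -!powRM//.
have [xy|yx] := leP x y.
  rewrite (@le_trans _ _ ((2 * y) `^ s))//; last by rewrite lerDr powR_ge0.
  by rewrite ge0_ler_powR ?nnegrE ?addr_ge0 ?mulr_ge0// mulr_natl mulr2n lerD2r.
rewrite (@le_trans _ _ ((2 * x) `^ s))//; last by rewrite lerDl powR_ge0.
by rewrite ge0_ler_powR ?nnegrE ?addr_ge0 ?mulr_ge0// mulr_natl mulr2n lerD2l ltW.
Qed.

Lemma powR_subadd s (x y : R) : 0 < s -> s <= 1 -> 0 <= x -> 0 <= y ->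
  (x + y) `^ s <= x `^ s + y `^ s.
Proof.
move=> s0 s1; rewrite le_eqVlt => /predU1P[<- y0|x0].
  by rewrite add0r powR0 ?add0r// gt_eqF.
rewrite le_eqVlt => /predU1P[<-|y0].
  by rewrite addr0 powR0 ?addr0// gt_eqF.
have xy0 : 0 < x + y by rewrite addr_gt0.
have key (z : R) : 0 < z -> z <= x + y ->
    z / (x + y) * (x + y) `^ s <= z `^ s.
  move=> z0 zxy; rewrite -{2}[z](divfK (lt0r_neq0 xy0)).
  rewrite powRM ?divr_ge0 ?(ltW z0) ?(ltW xy0)// ler_wpM2r ?powR_ge0//.
  by rewrite ger1_powR// divr_gt0//= ler_pdivrMr// mul1r.
have := lerD (key x x0 _) (key y y0 _).
rewrite lerDl lerDr -mulrDl -mulrDl divff ?lt0r_neq0// mul1r; apply; exact: ltW.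
Qed.

Lemma ell_setB s f g : 0 < s -> ell_set s f -> ell_set s g ->
  ell_set s (f \- g).
Proof.
move=> s0 sf sg; rewrite /ell_set/=.
apply: (@le_lt_trans _ _ ((2 `^ s)%:E * pow_sum s f +
    (2 `^ s)%:E * pow_sum s g)%E); last first.
  by rewrite lte_add_pinfty// lte_mul_pinfty// lee_fin powR_ge0.
have h0 u n : (0 <= (normc (u n) `^ s)%:E :> \bar R)%E by rewrite lee_fin powR_ge0.
rewrite pow_sum.unlock -!nneseriesZl// -nneseriesD//; last 2 first.
- by move=> n _ _; rewrite mule_ge0// lee_fin powR_ge0.
- by move=> n _ _; rewrite mule_ge0// lee_fin powR_ge0.
apply: lee_nneseries => [n _ _|n _]; first exact: h0.
rewrite -!EFinM -EFinD lee_fin.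
rewrite (le_trans _ (powR_leD (ltW s0) (normc_ge0 _) (normc_ge0 _)))//.
rewrite ge0_ler_powR ?nnegrE ?addr_ge0 ?normc_ge0 ?(ltW s0)//=.
by rewrite (le_trans (le_normcD _ _))// normcN.
Qed.

Lemma pow_sum_Lnorm s f : 0 < s -> ell_set s f ->
  ((fine (pow_sum s f) `^ s^-1)%:E =
   Lnorm counting s%:E (fun n => (normc (f n))%:E))%E.
Proof.
move=> s0 sf; rewrite -poweR_EFin fineK ?pow_sum_fin// Lnorm_counting//.
congr (_ `^ _)%E.
by rewrite pow_sum.unlock; apply: eq_eseriesr => n _ /=; rewrite ger0_norm ?normc_ge0// poweR_EFin.
Qed.

Lemma ell_distxx s f : 0 < s -> ell_dist s f f = 0.
Proof.
move=> s0; rewrite /ell_dist pow_sumxx//=; case: ifP => // _.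
by rewrite powR0// invr_neq0// gt_eqF.
Qed.

Lemma ell_dist_sym s f g : ell_dist s f g = ell_dist s g f.
Proof. by rewrite /ell_dist pow_sum_distC. Qed.

Lemma ell_dist_eq0 s f g : 0 < s -> ell_set s f -> ell_set s g ->
  ell_dist s f g = 0 -> f = g.
Proof.
move=> s0 sf sg fg0; have sfg := ell_setB s0 sf sg.
have {}fg0 : pow_sum s (f \- g) = 0%E.
  rewrite -(fineK (pow_sum_fin sfg)); congr EFin.
  by move: fg0; rewrite /ell_dist; case: ifP => // _; exact: powR_eq0_eq0.
apply/funext => n; apply/eqP; rewrite -subr_eq0; apply/eqP.
apply: eq0_normc; apply: (@powR_eq0_eq0 _ _ s).
apply/eqP; rewrite eq_le powR_ge0 andbT -lee_fin.
by have := le_pow_sum s (f \- g) n; rewrite fg0.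
Qed.

Lemma ell_dist_triangle s g f h : 0 < s ->
  ell_set s f -> ell_set s g -> ell_set s h ->
  ell_dist s f h <= ell_dist s f g + ell_dist s g h.
Proof.
move=> s0 sf sg sh.
have sfg := ell_setB s0 sf sg; have sgh := ell_setB s0 sg sh.
have sfh := ell_setB s0 sf sh.
rewrite /ell_dist; case: ifPn => [s1|]; last first.
  rewrite -ltNge => /ltW s1.
  rewrite -lee_fin EFinD (fineK (pow_sum_fin sfh)) (fineK (pow_sum_fin sfg)).
  rewrite (fineK (pow_sum_fin sgh)) pow_sum.unlock.
  have h0 u n : (0 <= (normc (u n) `^ s)%:E :> \bar R)%E by rewrite lee_fin powR_ge0.
  rewrite -nneseriesD//.
  apply: lee_nneseries => [n _ _|n _]; first exact: h0.
  rewrite -EFinD lee_fin (le_trans _ (powR_subadd s0 s1 _ _)) ?normc_ge0//.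
  rewrite ge0_ler_powR ?nnegrE ?addr_ge0 ?normc_ge0 ?(ltW s0)//.
  exact: normc_dist_triangle.
rewrite -lee_fin EFinD (pow_sum_Lnorm s0 sfh) (pow_sum_Lnorm s0 sfg).
rewrite (pow_sum_Lnorm s0 sgh).
apply: le_trans (@minkowski_EFin _ _ R counting (fun n => normc (f n - g n))
  (fun n => normc (g n - h n)) s _ _ s1) => //.
have nn (x : \bar R) : (0 <= x)%E -> x \in `[0%E, +oo%E].
  by move=> x0; rewrite in_itv/= x0 leey.
rewrite !Lnorm_counting//; apply: gt0_ler_poweR.
- by rewrite invr_ge0 ltW.
- by apply: nn; apply: nneseries_ge0 => n _ _; exact: poweR_ge0.
- by apply: nn; apply: nneseries_ge0 => n _ _; exact: poweR_ge0.
apply: lee_nneseries => [n _ _|n _]; first exact: poweR_ge0.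
apply: gt0_ler_poweR; rewrite ?(ltW s0)//; [exact: nn|exact: nn|].
rewrite /= lee_fin !ger0_norm ?addr_ge0 ?normc_ge0//.
exact: normc_dist_triangle.
Qed.

End Carriers.

Section Spaces.
Context {R : realType}.

Definition linf : Type := set_type (@linf_set R).
Definition c0 : Type := set_type (@c0_set R).
Definition ell (s : {posnum R}) : Type := set_type (ell_set s%:num).

HB.instance Definition _ := Choice.copy linf (set_type (@linf_set R)).
HB.instance Definition _ := Choice.copy c0 (set_type (@c0_set R)).
HB.instance Definition _ s := Choice.copy (ell s) (set_type (ell_set s%:num)).

Let linfP (f : linf) : linf_set (val f) := set_valP f.
Let c0P (f : c0) : linf_set (val f) := c0_set_linf (set_valP f).
Let ellP s (f : ell s) : ell_set s%:num (val f) := set_valP f.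

HB.instance Definition _ := @isMetric.Build R linf
  (fun f g => sup_dist (val f) (val g))
  (fun f => sup_distxx (val f))
  (fun f g fg0 => val_inj (sup_dist_eq0 (linfP f) (linfP g) fg0))
  (fun f g => sup_dist_sym (val f) (val g))
  (fun g f h => sup_dist_triangle (linfP f) (linfP g) (linfP h)).

HB.instance Definition _ := @isMetric.Build R c0
  (fun f g => sup_dist (val f) (val g))
  (fun f => sup_distxx (val f))
  (fun f g fg0 => val_inj (sup_dist_eq0 (c0P f) (c0P g) fg0))
  (fun f g => sup_dist_sym (val f) (val g))
  (fun g f h => sup_dist_triangle (c0P f) (c0P g) (c0P h)).

HB.instance Definition _ s := @isMetric.Build R (ell s)
  (fun f g => ell_dist s%:num (val f) (val g))
  (fun f => ell_distxx (val f) (gt0 s))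
  (fun f g fg0 => val_inj (ell_dist_eq0 (gt0 s) (ellP f) (ellP g) fg0))
  (fun f g => ell_dist_sym s%:num (val f) (val g))
  (fun g f h => ell_dist_triangle (gt0 s) (ellP f) (ellP g) (ellP h)).

End Spaces.
Arguments linf : clear implicits.
Arguments c0 : clear implicits.

Section CapSpace.
Context {R : realType} (a : {nonneg R}).

Definition capell : Type := set_type (capell_set a%:num).

HB.instance Definition _ := Choice.copy capell (set_type (capell_set a%:num)).

Definition capell_ell (f : capell)
    (s : {s : {posnum R} | a%:num < s%:num}) : ell (sval s) :=
  SigSub (mem_set (set_valP f _ (svalP s))).

HB.instance Definition _ := Topological.copy capell
  (sup_topology (fun s => Topological.class
    (initial_topology (fun f : capell => capell_ell f s)))).

Lemma cvg_capellP (F : set_system capell) (f : capell) : Filter F ->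
  F --> f <-> forall s, capell_ell h s @[h --> F] --> capell_ell f s.
Proof.
move=> FF; apply: (iff_trans (cvg_sup _ _ _)); split=> cF s.
  apply: (cvg_trans _ (@initial_continuous _ _ (capell_ell ^~ s) f)).
  by apply: cvg_app; exact: cF.
move=> A; rewrite nbhsE => -[_ [[B oB <-] Bf] BA].
by apply: filterS BA _; apply: cF; exact: open_nbhs_nbhs.
Qed.

End CapSpace.

Variant seq_space (R : realType) :=
  | Linf | C0 | Ell of {posnum R} | CapEll of {nonneg R}.
Arguments Linf {R}.
Arguments C0 {R}.

Section SeqSpace.
Context {R : realType}.

Definition space_of (Y : seq_space R) : topologicalType :=
  match Y with
  | Linf => linf R
  | C0 => c0 R
  | Ell s => ell s
  | CapEll a => capell a
  end.

Definition carrier (Y : seq_space R) : set (nat -> R[i]) :=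
  match Y with
  | Linf => linf_set
  | C0 => c0_set
  | Ell s => ell_set s%:num
  | CapEll a => capell_set a%:num
  end.

Definition seq_of (Y : seq_space R) : space_of Y -> nat -> R[i] :=
  match Y with
  | Linf | C0 | Ell _ | CapEll _ => fun f => val f
  end.

Lemma range_seq_of (Y : seq_space R) : range (@seq_of Y) = carrier Y.
Proof.
apply/seteqP; split.
  by move=> _ [f _ <-]; case: Y f => [||s|a] f; exact: (set_valP f).
by case: Y => [||s|a] f /mem_set fY; exists (SigSub fY).
Qed.

End SeqSpace.

Definition Fsigma_meager (T : topologicalType) (A : set T) :=
  exists2 F : (set T)^nat,
    (forall i, closed (F i) /\ (F i)° = set0) & A = \bigcup_i F i.

(* Main.v *)
(* X is the union over k of F_k = {f in Y | sum_n |f n|^p <= k}. Each F_k is   *)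
(* closed, being cut out by the conditions sum_(n < N) |f n|^p <= k, which     *)
(* involve finitely many coordinates, and coordinates are continuous on Y.     *)
(* If f is interior to F_k and g is in Y \ X, then f - g/(m+1) tends to f in   *)
(* Y, so it lies in F_k, hence in X, for large m; since X is a vector space,   *)
(* g is in X, a contradiction.                                                 *)
Require Import Defs.
From HB Require Import structures.
From mathcomp Require Import all_boot all_order all_algebra.
From mathcomp Require Import complex.
From mathcomp Require Import all_classical all_reals all_analysis.

Set Implicit Arguments.
Unset Strict Implicit.
Unset Printing Implicit Defensive.

Import Order.TTheory GRing.Theory Num.Theory.
Import numFieldNormedType.Exports ComplexField.Normc.

Local Open Scope complex_scope.
Local Open Scope classical_set_scope.
Local Open Scope ring_scope.

(** Two facts about [Y] carry the argument, and both hold for all four kinds of space. Coordinates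
    are continuous ([seq_of_coord_continuous]), so the sublevel sets of [pow_sum] are closed
    ([closed_pow_sum_le]). Line segments are continuous: f - g/(m+1) stays in [Y] and tends to f
    ([cvg_seq_of_subZ]), so no sublevel set can have an interior point once some g lies in [Y] but
    not in [ell p]. For exponents on either side of 1, [cvg_ellP] reduces convergence in [ell s] to
    that of [pow_sum]. *)

(* The absolute value is needed because [x `^ s] is 1 for [x < 0]. *)
Lemma continuous_norm_powR (R : realType) (s : R) :
  0 < s -> continuous (fun x : R => `|x| `^ s).
Proof.
move=> s0 x; have [->|x0] := eqVneq x 0.
  rewrite /continuous_at normr0 powR0 ?gt_eqF//; apply/cvgr0Pnorm_lt => e e0.
  near=> y; rewrite ger0_norm ?powR_ge0//.
  (* Writing e as an s-th power turns the goal into |y| < e^(1/s). *)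
  have -> : e = (e `^ s^-1) `^ s.
    by rewrite -powRrM mulVf ?gt_eqF// powRr1// ltW.
  rewrite gt0_ltr_powR ?nnegrE ?powR_ge0//.
  near: y; apply: (@cvgr0_norm_lt _ _ _ _ _ (fun y : R => y)); first exact: cvg_id.
  exact: powR_gt0.
apply: (@continuous_comp _ _ _ (fun x : R => `|x|) (fun y => y `^ s)).
  exact: norm_continuous.
apply: differentiable_continuous; apply/derivable1_diffP.
by apply: derivable_powR; rewrite in_itv/= andbT normr_gt0.
Unshelve. all: by end_near. Qed.

Lemma cvg_mdistP (R : realType) (V : metricType R) (T : Type)
    (F : set_system T) {FF : Filter F} (h : T -> V) (f : V) :
  h x @[x --> F] --> f <-> mdist f (h x) @[x --> F] --> (0 : R).
Proof.
split=> [/metricType_numDomainType.cvgrPdist_lt hf|hf].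
  apply/cvgr0Pnorm_lt => e /hf; apply: filterS => x.
  by rewrite ger0_norm// mdist_ge0.
apply/metricType_numDomainType.cvgrPdist_lt => e e0.
move/cvgr0Pnorm_lt: hf => /(_ _ e0); apply: filterS => x.
by rewrite ger0_norm// mdist_ge0.
Qed.

Section Modulus.
Context {R : realType}.
Implicit Types (f g : nat -> R[i]) (s t : R).

Lemma normc_real t : normc t%:C = `|t|.
Proof. by rewrite /= expr0n/= addr0 sqrtr_sqr. Qed.

Lemma pow_sumZ s t f : 0 < s ->
  pow_sum s (fun n => t%:C * f n) = ((`|t| `^ s)%:E * pow_sum s f)%E.
Proof.
move=> s0; rewrite pow_sum.unlock -nneseriesZl; last first.
  by move=> n _; rewrite lee_fin powR_ge0.
apply: eq_eseriesr => n _.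
by rewrite normcM normc_real powRM ?normc_ge0// EFinM.
Qed.

Lemma ell_setZ s t f : 0 < s -> ell_set s f ->
  ell_set s (fun n => t%:C * f n).
Proof.
by move=> s0 sf; rewrite /ell_set/= pow_sumZ// lte_mul_pinfty// lee_fin powR_ge0.
Qed.

Lemma linf_setZ t f : linf_set f -> linf_set (fun n => t%:C * f n).
Proof.
move=> [M fM]; exists (`|t| * M) => _ [n _ <-] /=.
by rewrite normcM normc_real ler_wpM2l//; exact: fM.
Qed.

Lemma sup_distZ t f g : linf_set g ->
  sup_dist f (f \- (fun n => t%:C * g n)) <= `|t| * sup_dist g (fun=> 0).
Proof.
move=> lg; apply: ge_sup; first by eexists; exists 0%N.
move=> _ [n _ <-] /=; rewrite subKr normcM normc_real ler_wpM2l//.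
rewrite -[g n]subr0; apply: le_sup_dist => //.
by exists 0 => _ [k _ <-]; rewrite normc0.
Qed.

(** A single term is at most the whole nonnegative series; take s-th roots. This bound makes the
    coordinates continuous on [ell s]. *)
Lemma le_pow_sum_root s f n : 0 < s -> ell_set s f ->
  normc (f n) <= fine (pow_sum s f) `^ s^-1.
Proof.
move=> s0 sf; have := le_pow_sum s f n.
rewrite -{1}(fineK (pow_sum_fin sf)) lee_fin => fs.
have -> : normc (f n) = (normc (f n) `^ s) `^ s^-1.
  by rewrite -powRrM mulfV ?gt_eqF// powRr1// normc_ge0.
by rewrite ge0_ler_powR ?nnegrE ?powR_ge0 ?invr_ge0 ?(ltW s0)// fine_ge0// pow_sum_ge0.
Qed.

End Modulus.

(** The distance is the power sum or its s-th root, and raising to a positive power, in either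
    direction, preserves convergence to 0. *)
Lemma cvg_ellP (R : realType) (s : {posnum R}) (T : Type)
    (F : set_system T) {FF : Filter F} (h : T -> ell s) (f : ell s) :
  h x @[x --> F] --> f <->
  fine (pow_sum s%:num (val f \- val (h x))) @[x --> F] --> (0 : R).
Proof.
pose P x := fine (pow_sum s%:num (val f \- val (h x))).
have P0 x : 0 <= P x by rewrite fine_ge0// pow_sum_ge0.
have powcvg (r : R) (u : T -> R) : 0 < r -> (forall x, 0 <= u x) ->
    u x @[x --> F] --> (0 : R) -> u x `^ r @[x --> F] --> (0 : R).
  move=> r0 u0 uF.
  have /(_ 0) := continuous_norm_powR r0.
  rewrite /continuous_at normr0 powR0 ?gt_eqF// => c0.
  have := cvg_comp _ _ uF c0; apply: cvg_trans; apply: near_eq_cvg.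
  by apply: nearW => x /=; rewrite ger0_norm.
apply: (iff_trans (cvg_mdistP _ _)).
have -> : (fun x => mdist f (h x)) =
    (fun x => if 1 <= s%:num then P x `^ s%:num^-1 else P x) by [].
rewrite -/P; case: (1 <= s%:num) => //; split => [PF|]; last first.
  by apply: powcvg => //; rewrite invr_gt0.
have -> : P = (fun x => (P x `^ s%:num^-1) `^ s%:num).
  by apply/funext => x; rewrite -powRrM mulVf// powRr1.
by apply: powcvg => // x; exact: powR_ge0.
Qed.

(** Reverse triangle inequality. Everything is phrased through the real-valued modulus, so no
    topology on [R[i]] enters. *)
Lemma cvg_normc_dist (R : realType) (T : Type) (F : set_system T)
    {FF : Filter F} (z : T -> R[i]) (w : R[i]) :
  normc (w - z x) @[x --> F] --> (0 : R) -> normc (z x) @[x --> F] --> normc w.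
Proof.
move=> wz; apply/cvgrPdist_le => e e0.
move/cvgr0Pnorm_le: wz => /(_ _ e0); apply: filterS => x.
rewrite ger0_norm ?normc_ge0//; apply: le_trans.
have tri (a b : R[i]) : normc a - normc b <= normc (a - b).
  by rewrite lerBlDr -{1}(subrK b a) le_normcD.
by rewrite ler_norml lerNl opprB tri normc_distC tri.
Qed.

Lemma capell_ell_continuous (R : realType) (a : {nonneg R})
    (s : {s : {posnum R} | a%:num < s%:num}) :
  continuous (fun f : capell a => capell_ell f s).
Proof.
move=> f.
exact: (iffLR (@cvg_capellP _ _ (nbhs f) f (nbhs_filter f)) (@cvg_id _ _) s).
Qed.

Lemma ell_coord_continuous (R : realType) (s : {posnum R}) (n : nat) :
  continuous (fun f : ell s => normc (val f n)).
Proof.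
move=> f; apply: (cvg_normc_dist (F := nbhs f) (z := fun g : ell s => val g n)).
have /cvg_ellP P0 : g @[g --> f] --> f by exact: cvg_id.
have r0 : 0 < s%:num^-1 :> R by [].
have /(_ 0) := continuous_norm_powR r0.
rewrite /continuous_at normr0 powR0 ?gt_eqF// => /(cvg_comp _ _ P0).
apply: squeeze_cvgr; last exact: cvg_cst.
apply: nearW => g; rewrite normc_ge0/= ger0_norm ?fine_ge0 ?pow_sum_ge0//.
apply: (@le_pow_sum_root _ _ (val f \- val g)) => //.
by apply: ell_setB => //; exact: set_valP.
Qed.

Lemma seq_of_coord_continuous (R : realType) (Y : seq_space R) (n : nat) :
  continuous (fun f : space_of Y => normc (seq_of f n)).
Proof.
case: Y => [||s|a] /= f.
- apply: (cvg_normc_dist (F := nbhs f) (z := fun g : linf R => val g n)).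
  have /cvg_mdistP : g @[g --> f] --> f by exact: cvg_id.
  apply: squeeze_cvgr; last exact: cvg_cst.
  apply: nearW => g; rewrite normc_ge0/=.
  by apply: le_sup_dist; exact: set_valP.
- apply: (cvg_normc_dist (F := nbhs f) (z := fun g : c0 R => val g n)).
  have /cvg_mdistP : g @[g --> f] --> f by exact: cvg_id.
  apply: squeeze_cvgr; last exact: cvg_cst.
  apply: nearW => g; rewrite normc_ge0/=.
  by apply: le_sup_dist; apply: c0_set_linf; exact: set_valP.
- exact: ell_coord_continuous.
(* Any exponent above [a] would do: the coordinate factors through the continuous inclusion into
   that [ell s]. *)
- have a1 : 0 < a%:num + 1 by rewrite ltr_wpDl.
  have aa1 : a%:num < (PosNum a1)%:num by rewrite /= ltrDl.
  pose s : {s : {posnum R} | a%:num < s%:num} := exist _ (PosNum a1) aa1.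
  apply: (@continuous_comp _ _ _ (fun f : capell a => capell_ell f s)
    (fun f => normc (val f n))).
  + exact: capell_ell_continuous.
  + exact: ell_coord_continuous.
Qed.

Lemma closed_pow_sum_le (R : realType) (Y : seq_space R) (s k : R) : 0 < s ->
  closed [set f : space_of Y | (pow_sum s (seq_of f) <= k%:E)%E].
Proof.
move=> s0.
pose S N (f : space_of Y) := \sum_(0 <= n < N) normc (seq_of f n) `^ s.
(* The terms are nonnegative, so the series is at most [k] exactly when every partial sum is. *)
have -> : [set f | (pow_sum s (seq_of f) <= k%:E)%E] =
    \bigcap_(N in [set: nat]) (S N @^-1` [set x | x <= k]).
  apply/seteqP; split=> f /= fk; rewrite pow_sum.unlock in fk *.
    move=> N _ /=; rewrite -lee_fin -sumEFin; apply: le_trans fk.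
    by apply: nneseries_lim_ge => n _ _; rewrite lee_fin powR_ge0.
  apply: lime_le.
    by apply: is_cvg_nneseries => n _ _; rewrite lee_fin powR_ge0.
  by apply: nearW => N; rewrite sumEFin lee_fin; exact: fk.
apply: closed_bigI => N _; apply: preimage_closed; last exact: closed_le.
move=> f _; rewrite /S; elim: N => [|N IHN].
  by under eq_fun do rewrite big_nil; exact: cst_continuous.
under eq_fun do rewrite big_nat_recr//=; apply: continuousD IHN _.
have -> : (fun f : space_of Y => normc (seq_of f N) `^ s) =
    (fun x : R => `|x| `^ s) \o (fun f : space_of Y => normc (seq_of f N)).
  by apply/funext => g /=; rewrite ger0_norm// normc_ge0.
apply: continuous_comp; first exact: seq_of_coord_continuous.
exact: continuous_norm_powR.
Qed.

(** The difference f - h m is g/(m+1), whose power sum is that of g times (1/(m+1))^s. Keeping [h]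
    abstract lets the lemma serve both [ell s] and each component of [capell a]. *)
Lemma cvg_ell_subZ (R : realType) (s : {posnum R}) (g : nat -> R[i])
    (h : nat -> ell s) (f : ell s) :
  (forall m, val (h m) = val f \- (fun n => (harmonic m)%:C * g n)) ->
  ell_set s%:num g -> h m @[m --> \oo] --> f.
Proof.
move=> hE sg; apply/cvg_ellP.
have -> : (fun m => fine (pow_sum s%:num (val f \- val (h m)))) =
    (fun m => `|harmonic m| `^ s%:num * fine (pow_sum s%:num g)).
  apply/funext => m; rewrite -[RHS]/(fine (_%:E)) EFinM fineK ?pow_sum_fin//.
  rewrite -pow_sumZ// hE; congr (fine (pow_sum _ _)).
  by apply/funext => n /=; rewrite subKr.
rewrite -[X in _ --> X](mul0r (fine (pow_sum s%:num g))).
apply: cvgM (cvg_cst _); have s0 : 0 < s%:num by [].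
have /(_ 0) := continuous_norm_powR s0.
rewrite /continuous_at normr0 powR0 ?gt_eqF//.
by apply: cvg_comp; exact: cvg_harmonic.
Qed.

Lemma cvg_seq_of_subZ (R : realType) (Y : seq_space R) (g : nat -> R[i])
    (f : space_of Y) : carrier Y g ->
  exists2 h : nat -> space_of Y,
    forall m, seq_of (h m) = seq_of f \- (fun n => (harmonic m)%:C * g n) &
    h m @[m --> \oo] --> f.
Proof.
have sup_cvg (V : metricType R) (u : nat -> V) (v : V) (r : R) :
    (forall m, mdist v (u m) <= `|harmonic m| * r) -> u m @[m --> \oo] --> v.
  move=> uv; apply/cvg_mdistP.
  have : `|harmonic m| * r @[m --> \oo] --> (0 : R).
    rewrite -(mul0r r) -[X in X * r](normr0 R); apply: cvgM; last exact: cvg_cst.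
    by apply: cvg_norm; exact: cvg_harmonic.
  apply: squeeze_cvgr; last exact: cvg_cst.
  by apply: nearW => m; rewrite mdist_ge0 uv.
case: Y f => [||s|a] /= f Yg.
- have Yh m : linf_set (val f \- (fun n => (harmonic m)%:C * g n)).
    by apply: linf_setB; [exact: set_valP|exact: linf_setZ].
  exists (fun m => SigSub (mem_set (Yh m)) : linf R) => //.
  by apply: sup_cvg => m; exact: sup_distZ.
- have Yh m : c0_set (val f \- (fun n => (harmonic m)%:C * g n)).
    have f0 : normc (val f n) @[n --> \oo] --> (0 : R) := set_valP f.
    have : normc (val f n) + `|harmonic m| * normc (g n) @[n --> \oo] -->
        (0 : R).
      rewrite -(addr0 0) -[X in _ + X](mulr0 `|harmonic m|).
      by apply: cvgD => //; apply: cvgM => //; exact: cvg_cst.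
    apply: squeeze_cvgr; last exact: cvg_cst.
    apply: nearW => n; rewrite normc_ge0/= (le_trans (le_normcD _ _))//.
    by rewrite normcN normcM normc_real.
  exists (fun m => SigSub (mem_set (Yh m)) : c0 R) => //.
  by apply: sup_cvg => m; apply: sup_distZ; exact: c0_set_linf.
- have Yh m : ell_set s%:num (val f \- (fun n => (harmonic m)%:C * g n)).
    by apply: ell_setB => //; [exact: set_valP|exact: ell_setZ].
  exists (fun m => SigSub (mem_set (Yh m)) : ell s) => //.
  exact: (cvg_ell_subZ (g := g)).
- have Yh m : capell_set a%:num (val f \- (fun n => (harmonic m)%:C * g n)).
    move=> s /= sa; have s0 : 0 < s by exact: le_lt_trans sa.
    apply: ell_setB => //; first exact: (set_valP f).
    by apply: ell_setZ => //; exact: Yg.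
  exists (fun m => SigSub (mem_set (Yh m)) : capell a) => //.
  apply/cvg_capellP => s; apply: (cvg_ell_subZ (g := g)) => //.
  by apply: Yg; exact: (svalP s).
Qed.

Theorem proposition1 (R : realType) (p : {posnum R}) (Y : seq_space R) :
  carrier (Ell p) `<=` carrier Y ->
  carrier Y `\` carrier (Ell p) !=set0 ->
  Fsigma_meager [set f : space_of Y | carrier (Ell p) (seq_of f)].
Proof.
move=> _ [g [Yg Xg]].
exists (fun k => [set f : space_of Y | (pow_sum p%:num (seq_of f) <= k%:R%:E)%E]).
  move=> k; split; first exact: closed_pow_sum_le.
  apply/seteqP; split => // f /= fk; apply: Xg => /=.
  have Xle (u : space_of Y) : (pow_sum p%:num (seq_of u) <= k%:R%:E)%E ->
      ell_set p%:num (seq_of u) by move=> /le_lt_trans; apply; exact: ltry.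
  (* The sublevel set is a neighbourhood of [f], so it contains some [h m]. *)
  have [h hE /(_ _ fk)[m _ /(_ _ (leqnn m)) /= /Xle Xh]] := cvg_seq_of_subZ f Yg.
  have /Xle Xf := interior_subset fk.
  (* Solving h m = f - g/(m+1) for [g] exhibits it as a multiple of a difference of two elements of
     [ell p]. *)
  have -> : g = fun n => m.+1%:R%:C * (seq_of f \- seq_of (h m)) n.
    apply/funext => n; rewrite hE/= subKr mulrA -rmorphM/= mulfV ?pnatr_eq0//.
    by rewrite mul1r.
  by apply: ell_setZ => //; exact: ell_setB.
apply/seteqP; split=> f /=.
  move=> Xf; exists (Num.bound (fine (pow_sum p%:num (seq_of f)))) => //=.
  rewrite -(fineK (pow_sum_fin Xf)) lee_fin ltW// archi_boundP//.
  by rewrite fine_ge0// pow_sum_ge0.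
by move=> [k _ /= /le_lt_trans]; apply; exact: ltry.
Qed.
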